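(* Let $N,K,\delta_1,\delta_2$ be integers with $1\le K\le N$ and $0\le\delta_1\le\delta_2<N$. Consider the 2-Choice case of the Sliding-Window Secretary Problem with $N$ applicants, window size $K$ and thresholds $\delta_1,\delta_2$, and let $a\le N$ be an integer. If $a>\delta_1$ and $q=\left\lceil\frac{a-\delta_1}{K}\right\rceil$, then $$\sigma_1(a)=\sigma_1(\delta_1+(q-1)K)+\frac1N\sum_{j=\delta_1+(q-1)K+1}^{a}\left(1-\sum_{r=-1}^{q-2}f(\delta_1,\delta_1+rK)-f(\delta_1,j-K)\right).$$ If $a>\delta_2$ and $q=\left\lceil\frac{a-\delta_2}{K}\right\rceil$, then $$\sigma_2(a)=\sigma_2(\delta_2+(q-1)K)+\frac{p_b}{N}\sum_{j=\delta_2+(q-1)K+1}^{a}\left(1-\sum_{r=-1}^{q-2}f(\delta_2,\delta_2+rK)-f(\delta_2,j-K)\right).$$ If $a>\delta_2$, then $$\sigma_3(a)=\sigma_3(a-1)+\frac1N\sum_{m=\delta_2-K+2}^{a-1}g(m,\delta_1,a).$$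
   Context: Setting (2-Choice case). There are $N$ applicants with indices $1,\dots,N$. $R$ is a uniformly random permutation of $\{1,\dots,N\}$; $R(m)$ is the rank of the applicant at index $m$, with $1$ the best rank. When the window starts at index $i$ it consists of applicants $i,\dots,\min(i+K-1,N)$, and exactly the applicants $1,\dots,\min(i+K-1,N)$ have been seen. Under the sliding rule, applicant $i$ is a candidate iff $R(i)=\min\{R(1),\dots,R(\min(i+K-1,N))\}$. The strategy with thresholds $\delta_1,\delta_2$ rejects the first $\delta_1$ applicants, chooses (first choice) the first candidate $m_1>\delta_1$, and then chooses (second choice) the first candidate whose index is greater than both $m_1$ and $\delta_2$. The interviewer wins iff one of the chosen applicants has rank $1$. Winning probabilities. Three subcases: (i) the first choice is the winning choice; (ii) the second choice is the winning choice and the first choice was made before index $\delta_2-K+2$; (iii) the second choice is the winning choice and the first choice was made after index $\delta_2-K+1$. For $l=1,2,3$, $\sigma_l(a)$ is the probability of winning in subcase (i), (ii), (iii), respectively, with the winning applicant's index in $[1,a]$. Thus $\sigma_1(a)=0$ for $a\le\delta_1$, and $\sigma_2(a)=\sigma_3(a)=0$ for $a\le\delta_2$. Auxiliary quantities. For an integer $x\ge0$, consider the single-choice rule that makes no choice before index $x+1$ and chooses the first candidate with index $>x$. For $a>x$, $f(x,a)$ is the probability that this rule chooses an applicant with index in $\left[x+K\left(\lceil\frac{a-x}{K}\rceil-1\right)+1,\ a\right]$; $f(x,a)=0$ for $a\le x$. The number $c(m,x)$ is the probability that this rule makes its choice at index $m$; explicitly $c(m,x)=0$ for $m\le x$ and,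 for $m>x$, $$c(m,x)=\frac{1}{m+K-1}\left(1-\sum_{r=-1}^{\lceil\frac{m-x}{K}\rceil-2}f(x,x+rK)-f(x,m-K)\right).$$ Define $g(m,x,b)=0$ if $b-m<K$, and otherwise $$g(m,x,b)=c(m,x)\left(1-\sum_{r=-2}^{\lceil\frac{b-m-K+1}{K}\rceil-1}f(m+K-1,m+rK-1)-f(m+K-1,b-K)\right).$$ Finally, $p_b$ is the probability of making a choice between $\delta_1+1$ and $\delta_2-K+1$: $$p_b=\sum_{r=0}^{\lceil\frac{\delta_2-\delta_1-K+1}{K}\rceil-1}f(\delta_1,\delta_1+rK)+f(\delta_1,\delta_2-K+1).$$ *)

(* Defs.v *)
From mathcomp Require Import all_boot all_order all_algebra all_fingroup.
Set Implicit Arguments.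
Unset Strict Implicit.
Unset Printing Implicit Defensive.
Import Order.TTheory GRing.Theory Num.Theory.
Local Open Scope ring_scope.

(* The integers lo, lo + 1, ..., hi; empty when hi < lo. *)
Definition zrange (lo hi : int) : seq int :=
  if lo <= hi then [seq lo + k%:Z | k <- iota 0 `|hi - lo|%N.+1] else [::].

Notation "\zsum_ ( lo <= i <= hi ) F" := (\sum_(i <- zrange lo hi) F)
  (at level 41, lo at level 60, i name, hi at level 60, F at level 41,
   format "'[' \zsum_ ( lo  <=  i  <=  hi ) '/  '  F ']'").

Lemma mem_zrange (lo hi r : int) : (r \in zrange lo hi) = (lo <= r <= hi).
Proof.
rewrite /zrange; case: leP => [le_lh | lt_hl]; last first.
  rewrite in_nil; apply/esym/negP => /andP[l_r r_h].
  by have := lt_le_trans lt_hl (le_trans l_r r_h); rewrite ltxx.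
have hE : hi = lo + `|hi - lo|%N%:Z by rewrite gez0_abs ?subr_ge0 // subrKC.
apply/mapP/andP => [[k] | [l_r r_h]].
  rewrite mem_iota ltnS => /andP[_ k_le] ->; split; first by rewrite lerDl.
  by rewrite [leRHS]hE lerD2l lez_nat.
exists `|r - lo|%N; last by rewrite gez0_abs ?subr_ge0 // subrKC.
rewrite mem_iota ltnS /= -lez_nat !gez0_abs ?subr_ge0 //.
by rewrite lerD2r.
Qed.

Lemma zrange_uniq (lo hi : int) : uniq (zrange lo hi).
Proof.
rewrite /zrange; case: ifP => // _; rewrite map_inj_uniq ?iota_uniq //.
by move=> i j /addrI[].
Qed.

Definition ceil_div (a b : int) : int := Num.ceil (a%:~R / b%:~R : rat).

(* Applicants are the elements of 'I_N; their indices and ranks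
   run from 1 to N. *)
Definition index1 (N : nat) (i : 'I_N) : int := i.+1%:Z.

Definition rank1 (N : nat) (R : 'S_N) (i : 'I_N) : nat := (R i).+1.

(* N is neutral for the minimum since all ranks are at most N. *)
Definition candidate (N : nat) (K : int) (R : 'S_N) (i : 'I_N) : bool :=
  rank1 R i == \big[minn/N]_(j < N
    | index1 j <= Order.min (index1 i + K - 1) N%:Z) rank1 R j.

(* enum 'I_N is increasing, so this is the first candidate of index > x. *)
Definition first_candidate (N : nat) (K : int) (R : 'S_N) (x : int)
    : option 'I_N :=
  ohead [seq i <- enum 'I_N | candidate K R i && (x < index1 i)].

Definition first_choice (N : nat) (K d1 : int) (R : 'S_N) : option 'I_N :=
  first_candidate K R d1.

Definition second_choice (N : nat) (K d1 d2 : int) (R : 'S_N) : option 'I_N :=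
  if first_choice K d1 R is Some i
  then first_candidate K R (Order.max (index1 i) d2) else None.

(* Probability of an event on the uniformly random permutation R. *)
Definition Pr (N : nat) (A : {set 'S_N}) : rat := #|A|%:R / #|{: 'S_N}|%:R.

Definition sigma1 (N : nat) (K d1 a : int) : rat :=
  Pr [set R : 'S_N |
    if first_choice K d1 R is Some i
    then (rank1 R i == 1%N) && (1 <= index1 i <= a)
    else false].

Definition sigma2 (N : nat) (K d1 d2 a : int) : rat :=
  Pr [set R : 'S_N |
    match first_choice K d1 R, second_choice K d1 d2 R with
    | Some i, Some j => [&& rank1 R j == 1%N, index1 i < d2 - K + 2
                          & 1 <= index1 j <= a]
    | _, _ => false
    end].

Definition sigma3 (N : nat) (K d1 d2 a : int) : rat :=
  Pr [set R : 'S_N |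
    match first_choice K d1 R, second_choice K d1 d2 R with
    | Some i, Some j => [&& rank1 R j == 1%N, d2 - K + 1 < index1 i
                          & 1 <= index1 j <= a]
    | _, _ => false
    end].

Definition f (N : nat) (K x a : int) : rat :=
  if x < a then
    Pr [set R : 'S_N |
      if first_candidate K R x is Some i
      then x + K * (ceil_div (a - x) K - 1) + 1 <= index1 i <= a
      else false]
  else 0.

(* For x < m and m + K - 1 <= N this is the probability that the single-choice
   rule from x chooses index m.  For later m the window is truncated at N and
   the formula no longer gives that probability, but [g] below uses [c m x]
   only when m + K <= b, with b <= N. *)
Definition c (N : nat) (K m x : int) : rat :=
  if m <= x then 0 else
  (m + K - 1)%:~R^-1 *
  (1 - \zsum_(-1 <= r <= ceil_div (m - x) K - 2) f N K x (x + r * K)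
     - f N K x (m - K)).

Definition g (N : nat) (K m x b : int) : rat :=
  if b - m < K then 0 else
  c N K m x *
  (1 - \zsum_(-2 <= r <= ceil_div (b - m - K + 1) K - 1)
         f N K (m + K - 1) (m + r * K - 1)
     - f N K (m + K - 1) (b - K)).

Definition p_b (N : nat) (K d1 d2 : int) : rat :=
  \zsum_(0 <= r <= ceil_div (d2 - d1 - K + 1) K - 1) f N K d1 (d1 + r * K)
  + f N K d1 (d2 - K + 1).

(* Main.v *)
(* If the applicant at index j has rank 1, no applicant whose window contains j
   is a candidate, so a search started after x stops at j exactly when there is
   no candidate with index in (x, j - K].  This event depends only on the
   relative order of the first j - 1 applicants, hence is independent of j
   having rank 1.  More generally, an event determined by the relative order on
   a set U is independent of any event invariant under permuting U; this also
   separates the first search from the second one.  The sums of f telescope,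
   and their complements are the probabilities of finding no candidate. *)
Require Import Defs.
From mathcomp Require Import all_boot all_order all_algebra all_fingroup.
From mathcomp Require Import zify ring.
Set Implicit Arguments.
Unset Strict Implicit.
Unset Printing Implicit Defensive.
Import Order.TTheory GRing.Theory Num.Theory.
Local Open Scope ring_scope.

(** * Independence in the symmetric group, and elementary counting probabilities *)

Section Independence.
Variable N : nat.
Implicit Types (U T : {set 'I_N}) (R : 'S_N) (E M : {set 'S_N}).

Definition same_order U R R' :=
  forall i j, i \in U -> j \in U -> (R i <= R j)%N = (R' i <= R' j)%N.

Definition order_determined U E :=
  forall R R', same_order U R R' -> (R \in E) = (R' \in E).

(** Since [(t * R)%g i = R (t i)], the factor [t] redistributes the ranks that [R] gives among the
    applicants of [U] and leaves all other ranks alone. *)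
Definition perm_invariant U E :=
  forall t R, perm_on U t -> ((t * R)%g \in E) = (R \in E).

(** Sort [U] once by [R] and once by [R']; [t] sends the element at each position of the second list
    to the element at the same position of the first. *)
Lemma align_order U R R' :
  exists2 t : 'S_N, perm_on U t & same_order U (t * R)%g R'.
Proof.
pose s (Q : 'S_N) := sort (fun i j : 'I_N => (Q i <= Q j)%N) (enum U).
have mem_s Q x : (x \in s Q) = (x \in U) by rewrite mem_sort mem_enum.
have uniq_s Q : uniq (s Q) by rewrite sort_uniq enum_uniq.
have size_s Q : size (s Q) = #|U| by rewrite size_sort -cardE.
have sorted_s (Q : 'S_N) :
    sorted (fun i j : 'I_N => (Q i <= Q j)%N) (s Q).
  by apply: sort_sorted => x y; apply: leq_total.
have le_index (Q : 'S_N) x y : x \in U -> y \in U ->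
    (Q x <= Q y)%N = (index x (s Q) <= index y (s Q))%N.
  move=> xU yU.
  have mono u v : u \in U -> v \in U ->
      (index u (s Q) <= index v (s Q))%N -> (Q u <= Q v)%N.
    move=> uU vU; apply: (sorted_leq_index _ _ (sorted_s Q)); rewrite ?mem_s //.
    by move=> a b c; apply: leq_trans.
  apply/idP/idP; last exact: mono.
  rewrite leqNgt => xy; rewrite leqNgt; apply: contra xy => yx.
  rewrite ltn_neqAle mono ?(ltnW yx) // andbT.
  apply: contraTneq yx => /val_inj/perm_inj->.
  by rewrite ltnn.
(* Outside [U] the index equals the common size of both lists, so [nth] returns its default [x]:
   this is what makes [h Q Q'] fix the complement of [U]. *)
pose h Q Q' (x : 'I_N) := nth x (s Q) (index x (s Q')).
have hU Q Q' x : (h Q Q' x \in U) = (x \in U).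
  rewrite /h; case xU: (x \in U).
    by rewrite -(mem_s Q) mem_nth // size_s -(size_s Q') index_mem mem_s.
  by rewrite nth_default ?xU // size_s -(size_s Q') leqNgt index_mem mem_s xU.
have index_h Q Q' x : x \in U -> index (h Q Q' x) (s Q) = index x (s Q').
  by move=> xU; rewrite index_uniq // size_s -(size_s Q') index_mem mem_s.
have hout Q Q' x : x \notin U -> h Q Q' x = x.
  by move=> xU; rewrite /h nth_default // size_s -(size_s Q') leqNgt index_mem mem_s.
have hK Q Q' : cancel (h Q Q') (h Q' Q).
  move=> x; case: (boolP (x \in U)) => xU; last by rewrite !hout.
  by rewrite {1}/h index_h // nth_index ?mem_s.
exists (perm (can_inj (hK R R'))).
  by apply/subsetP => x; rewrite inE permE; apply: contraR => /hout->.
move=> i j iU jU; rewrite !permM !permE !le_index ?hU //.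
by rewrite !index_h.
Qed.

Lemma Pr_sum E : Pr E = (\sum_R (R \in E)%:R) / #|{: 'S_N}|%:R.
Proof.
rewrite /Pr -sum1_card natr_sum big_mkcond /=; congr (_ / _).
by apply: eq_bigr => R _; case: ifP.
Qed.

Lemma card_perms_neq0 : #|{: 'S_N}|%:R != 0 :> rat.
Proof. by rewrite pnatr_eq0 -lt0n; apply/card_gt0P; exists 1%g. Qed.

(* Averaging over the permutations supported on U: each coset sees every
   relative order on U equally often, whereas M is constant on it. *)
Lemma Pr_indep U E M : order_determined U E -> perm_invariant U M ->
  Pr (E :&: M) = Pr E * Pr M.
Proof.
move=> detE invM; pose e : rat := \sum_(t | perm_on U t) (t \in E)%:R.
have cosetE R : \sum_(t : 'S_N | perm_on U t) ((t * R)%g \in E)%:R = e.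
  (* Once [r * R] orders [U] as the identity does, [t * r * R] orders [U] as [t] does, so the coset
     sum no longer depends on [R]. *)
  have [r Ur orderR] := align_order U R 1%g.
  rewrite (reindex_inj (mulIg r)) /=.
  apply: eq_big => [t | t Ut].
    apply/idP/idP => [Utr|Ut]; last exact: perm_onM.
    by rewrite -(mulgK r t) perm_onM // perm_onV.
  have {}Ut : perm_on U t by rewrite -(mulgK r t) perm_onM // perm_onV.
  rewrite (detE _ t) // => i j iU jU; rewrite -mulgA !permM.
  by rewrite -!(permM r) orderR ?perm_closed // !perm1.
have Usum_neq0 : \sum_(t : 'S_N | perm_on U t) (1 : rat) != 0.
  rewrite sumr_const pnatr_eq0 -lt0n; apply/card_gt0P; exists 1%g.
  exact: perm_on1.
(* Double counting of the pairs [(t, R)] with [R] in [A] and [t * R] in [E]. *)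
have key A : perm_invariant U A ->
  (\sum_(t : 'S_N | perm_on U t) (1 : rat)) * \sum_R (R \in E :&: A)%:R
    = e * \sum_R (R \in A)%:R.
  move=> invA; rewrite mulr_suml.
  transitivity (\sum_(t : 'S_N | perm_on U t)
    \sum_R ((R \in A)%:R * ((t * R)%g \in E)%:R : rat)).
    apply: eq_bigr => t Ut; rewrite mul1r (reindex_inj (mulgI t)) /=.
    apply: eq_bigr => R _; rewrite inE invA //.
    by rewrite mulrC -natrM mulnb.
  rewrite exchange_big mulr_sumr; apply: eq_bigr => R _ /=.
  by rewrite -mulr_sumr cosetE mulrC.
(* The identity is taken for [M] and for the full set; comparing the two eliminates [e]. *)
have keyM := key _ invM.
have := key setT (fun t R _ => etrans (in_setT _) (esym (in_setT _))).
rewrite setIT => keyT.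
have -> : Pr M = (\sum_R (R \in M)%:R) / (\sum_R (R \in [set: 'S_N])%:R).
  rewrite Pr_sum; congr (_ / _).
  by rewrite -sum1_card natr_sum; apply: eq_big => R; rewrite ?inE.
rewrite !Pr_sum.
have sumT_neq0 : \sum_R (R \in [set: 'S_N])%:R != 0 :> rat.
  rewrite (eq_bigr (fun=> 1%:R)) => [|R _]; last by rewrite inE.
  by rewrite -natr_sum sum1_card card_perms_neq0.
have c0 := card_perms_neq0.
apply: (mulfI Usum_neq0).
rewrite mulrA keyM mulrA [X in _ = X * _]mulrA keyT.
by field; rewrite sumT_neq0 c0.
Qed.

Lemma PrD (P Q S : pred 'S_N) :
  (forall R, P R = Q R || S R) -> (forall R, ~~ (Q R && S R)) ->
  Pr [set R | P R] = Pr [set R | Q R] + Pr [set R | S R].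
Proof.
move=> PQS QS0; rewrite /Pr -mulrDl -natrD -cardsUI.
have -> : [set R | Q R] :&: [set R | S R] = set0.
  by apply/setP => R; rewrite !inE; apply/negbTE/QS0.
rewrite cards0 addn0; congr (#|pred_of_set _|%:R / _).
by apply/setP => R; rewrite !inE.
Qed.

Lemma Pr_pred0 (P : pred 'S_N) : P =1 pred0 -> Pr [set R | P R] = 0.
Proof.
move=> P0; rewrite /Pr (_ : [set R | P R] = set0) ?cards0 ?mul0r //.
by apply/setP => R; rewrite !inE P0.
Qed.

Lemma eq_Pr (P Q : pred 'S_N) : P =1 Q -> Pr [set R | P R] = Pr [set R | Q R].
Proof. by move=> PQ; congr Pr; apply/setP => R; rewrite !inE PQ. Qed.

Lemma PrC (P : pred 'S_N) : Pr [set R | ~~ P R] = 1 - Pr [set R | P R].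
Proof.
have -> : 1 = Pr [set R : 'S_N | true].
  by rewrite /Pr cardsT divff // card_perms_neq0.
rewrite (@PrD predT P (fun R => ~~ P R)) => [|R|R]; first by rewrite addrAC subrr add0r.
  by rewrite orbN.
by rewrite andbN.
Qed.

(** Composing with the transposition of [j] and [k] matches the permutations minimal at [k] with
    those minimal at [j], and every permutation has exactly one minimiser in [T]. *)
Lemma Pr_min T j : j \in T ->
  Pr [set R : 'S_N | [forall k in T, (R j <= R k)%N]] = #|T|%:R^-1.
Proof.
move=> jT.
pose m k := [set R : 'S_N | [forall l in T, (R k <= R l)%N]].
have m_const k : k \in T -> #|m k| = #|m j|.
  move=> kT; rewrite -(card_imset _ (mulgI (tperm j k))); congr #|pred_of_set _|.
  have tT l : (tperm j k l \in T) = (l \in T).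
    by case: tpermP => // ->; rewrite jT kT.
  apply/setP => R; apply/imsetP/idP => [[Q]|].
    rewrite !inE => /forall_inP Qk ->; apply/forall_inP => l lT.
    by rewrite !permM tpermL Qk // tT.
  rewrite inE => /forall_inP Rj; exists (tperm j k * R)%g.
    rewrite inE; apply/forall_inP => l lT.
    by rewrite !permM tpermR Rj // tT.
  by rewrite mulgA tperm2 mul1g.
have sum_m : (\sum_(k in T) #|m k| = #|{: 'S_N}|)%N.
  transitivity (\sum_(R : 'S_N) \sum_(k in T) (R \in m k))%N.
    rewrite exchange_big /=; apply: eq_bigr => k _.
    by rewrite -sum1_card big_mkcond; apply: eq_bigr => R _; case: ifP.
  rewrite -sum1_card; apply: eq_bigr => R _.
  case: (arg_minnP (fun k => (R k : nat)) jT) => k0 k0T k0min.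
  rewrite (bigD1 k0) //= big1 ?addn0 => [|k /andP[kT kk0]].
    by rewrite inE; apply/eqP; rewrite eqb1; apply/forall_inP => l; apply: k0min.
  apply/eqP; rewrite eqb0 inE; apply: contraNN kk0 => /forall_inP Rk.
  by rewrite -(inj_eq (@perm_inj _ R)) -val_eqE eqn_leq Rk //= k0min.
rewrite (eq_bigr (fun=> #|m j|)) // sum_nat_const in sum_m.
have T0 : #|T|%:R != 0 :> rat by rewrite pnatr_eq0 -lt0n; apply/card_gt0P; exists j.
have mj0 : #|m j|%:R != 0 :> rat.
  by have := card_perms_neq0; rewrite -sum_m natrM mulf_eq0 negb_or => /andP[].
by rewrite /Pr -sum_m natrM -/(m j); field; rewrite T0 mj0.
Qed.

End Independence.

(** * Ceiling division and sums over integer ranges *)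

Lemma ceil_div_eq (y K q : int) : 0 < K ->
  (ceil_div y K == q) = ((q - 1) * K < y <= q * K).
Proof.
move=> K0; have K0' : 0 < K%:~R :> rat by rewrite ltr0z.
by rewrite /ceil_div ceil_eq ltr_pdivlMr // ler_pdivrMr // -!rmorphM /= ltr_int ler_int.
Qed.

Lemma ceil_divP (y K : int) : 0 < K ->
  (ceil_div y K - 1) * K < y <= ceil_div y K * K.
Proof. by move=> K0; rewrite -ceil_div_eq. Qed.

Lemma big_zrange0 (V : nmodType) (F : int -> V) (lo hi : int) :
  hi < lo -> \zsum_(lo <= i <= hi) F i = 0.
Proof. by rewrite /zrange ltNge => /negbTE->; rewrite big_nil. Qed.

Lemma big_zrange_recr (V : nmodType) (F : int -> V) (lo hi : int) :
  lo <= hi ->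
  \zsum_(lo <= i <= hi) F i = \zsum_(lo <= i <= hi - 1) F i + F hi.
Proof.
rewrite /zrange => lohi; rewrite lohi -[in LHS]addn1 iotaD map_cat big_cat /=.
rewrite big_seq1; congr (_ + F _); last by lia.
case: ifP => lohi1; last first.
  by rewrite (_ : `|hi - lo|%N = 0%N) ?big_nil //; lia.
by rewrite (_ : `|hi - lo|%N = (absz (hi - 1 - lo)%R).+1) //; lia.
Qed.

(** Serves both to sum the values of [f] over blocks and to turn one-step recurrences into the sums
    of the theorem. *)
Lemma telescope_zrange (V : zmodType) (F G : int -> V) (b a : int) :
  b <= a -> (forall j, b < j <= a -> F j = F (j - 1) + G j) ->
  F a = F b + \zsum_(b + 1 <= j <= a) G j.
Proof.
move=> ba; have -> : a = b + `|a - b|%N by lia.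
elim: `|a - b|%N => [|n IHn] FG.
  by rewrite addr0 big_zrange0 ?addr0 //; lia.
rewrite big_zrange_recr; last by lia.
rewrite FG; last by lia.
rewrite (_ : b + n.+1 - 1 = b + n); last by lia.
by rewrite addrA -IHn // => j jb; apply: FG; lia.
Qed.

Lemma big_zrange_shift (V : nmodType) (F : int -> V) (lo hi e : int) :
  \zsum_(lo + e <= i <= hi + e) F i = \zsum_(lo <= i <= hi) F (i + e).
Proof.
rewrite /zrange lerD2r; case: ifP => _; last by rewrite !big_nil.
rewrite !big_map (_ : hi + e - (lo + e) = hi - lo); last by lia.
by apply: eq_bigr => k _; rewrite addrAC.
Qed.

Lemma ceil_divB1 (y K : int) : 0 < K ->
  ceil_div (y - K) K = ceil_div y K - 1.
Proof.
move=> K0; apply/eqP; rewrite ceil_div_eq //.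
by have := ceil_divP y K0; rewrite !mulrBl !mul1r; lia.
Qed.

(** * Candidates and the search for the first one *)

Section Candidates.
Variables (N : nat) (K : int).
Hypothesis K_gt0 : 0 < K.
Implicit Types (i j m : 'I_N) (R : 'S_N) (d t u x : int).

(** Ordinals count from 0 and indices from 1, whence the strict bound; truncation of the window at
    [N] is automatic because [j < N]. *)
Lemma candidateP R i :
  reflect (forall j, j%:Z < i%:Z + K -> (R i <= R j)%N) (candidate K R i).
Proof.
have windowE j : (index1 j <= Order.min (index1 i + K - 1) N%:Z) = (j%:Z < i%:Z + K).
  by rewrite /index1; have := ltn_ord j; lia.
rewrite /candidate (eq_bigl _ _ windowE).
rewrite (_ : \big[minn/N]_(j < N | _) _ =
  \big[Order.min/N]_(j < N | j%:Z < i%:Z + K) rank1 R j) //.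
rewrite eq_le bigmin_le_cond ?andbT; last by rewrite ltrDl.
apply/(iffP idP) => [/bigmin_geP[_ minR] j /minR //|minR].
apply/bigmin_geP.
split; first by rewrite /rank1 leEnat ltn_ord.
by move=> j /minR.
Qed.

Definition no_candidate R x t :=
  [forall i : 'I_N, candidate K R i ==> ~~ (x < index1 i <= t)].

Lemma no_candidateP R x t :
  reflect (forall i, candidate K R i -> x < index1 i -> t < index1 i)
          (no_candidate R x t).
Proof.
apply: (iffP forall_inP) => nc i Ri; have := nc i Ri.
  by move=> + xi; rewrite xi /= ltNge.
by move=> xit; apply/negP => /andP[/xit]; lia.
Qed.

Variant first_candidate_spec R x : option 'I_N -> Prop :=
  | FirstCandidate i of candidate K R i & x < index1 i &
      (forall j, candidate K R j -> x < index1 j -> (i <= j)%N) :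
      first_candidate_spec R x (Some i)
  | NoCandidate of (forall j, candidate K R j -> index1 j <= x) :
      first_candidate_spec R x None.

Lemma first_candidateP R x :
  first_candidate_spec R x (first_candidate K R x).
Proof.
have le_tr : transitive (fun i j : 'I_N => i <= j)%N by move=> j i k; apply: leq_trans.
rewrite /first_candidate; set P := (fun i => _).
have : sorted (fun i j => i <= j)%N [seq i <- enum 'I_N | P i].
  apply: sorted_filter => //.
  by have := iota_sorted 0 N; rewrite -val_enum_ord sorted_map.
have memP i : (i \in [seq i <- enum 'I_N | P i]) = P i.
  by rewrite mem_filter mem_enum andbT.
case: [seq i <- enum 'I_N | P i] memP => [|i s] memP /=.
  move=> _; constructor => j Rj; rewrite leNgt; apply/negP => xj.
  by have := memP j; rewrite /P Rj xj.
rewrite (path_sortedE le_tr) => /andP[/allP le_i _].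
have /andP[Ri xi] : P i by rewrite -memP in_cons eqxx.
constructor => // j Rj xj.
have : j \in i :: s by rewrite memP /P Rj xj.
by rewrite in_cons => /predU1P[->//|/le_i].
Qed.

(** The last [K - 1] places before a candidate [m] need no check: a candidate there has [m] in its
    window and lies in the window of [m], so the two ranks agree. *)
Lemma first_candidate_some R x m : x < index1 m ->
  (first_candidate K R x == Some m) =
  candidate K R m && no_candidate R x (index1 m - K).
Proof.
move=> xm; apply/eqP/andP => [|[Rm /no_candidateP nc]].
  case: first_candidateP => // i Ri xi le_i [im]; rewrite im in Ri le_i.
  split=> //; apply/no_candidateP => j Rj /(le_i _ Rj).
  by rewrite /index1; lia.
case: first_candidateP => [i Ri xi le_i|no_cand].
  congr Some; apply: (@perm_inj _ R); apply: val_inj; apply/eqP.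
  have := le_i _ Rm xm; have := nc _ Ri xi; rewrite /index1 => nci im.
  by rewrite eqn_leq (candidateP _ _ Ri) ?(candidateP _ _ Rm); lia.
by have := no_cand _ Rm; lia.
Qed.

Lemma first_candidate_le R x t :
  (if first_candidate K R x is Some i then index1 i <= t else false)
  = ~~ no_candidate R x t.
Proof.
case: first_candidateP => [i Ri xi le_i|no_cand].
  apply/idP/idP => [it|].
    by apply/no_candidateP => /(_ i Ri xi); lia.
  apply: contraNT => it; apply/no_candidateP => j Rj /(le_i _ Rj).
  by move: it; rewrite /index1; lia.
by apply/esym/negbF/no_candidateP => j /no_cand; lia.
Qed.

(** * Stopping probabilities and their expression through [f] *)

Lemma no_candidate_trivial R x t : t <= x -> no_candidate R x t.
Proof. by move=> tx; apply/no_candidateP => i _; lia. Qed.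

(** By [first_candidate_le], the distribution function of the index at which the search from [x]
    stops. *)
Definition hit x t : rat := Pr [set R | ~~ no_candidate R x t].

Definition miss x t : rat := Pr [set R | no_candidate R x t].

Lemma missE x t : miss x t = 1 - hit x t.
Proof. by rewrite /miss /hit PrC; ring. Qed.

Lemma hit0 x t : t <= x -> hit x t = 0.
Proof. by move=> tx; apply: Pr_pred0 => R; rewrite no_candidate_trivial. Qed.

(** [f] only counts the length-[K] block, measured from [x], in which [t] lies, so it is the
    increment of [hit] since the start of that block. *)
Lemma f_hit x t q : (q - 1) * K < t - x <= q * K ->
  f N K x t = hit x t - hit x (x + (q - 1) * K).
Proof.
move=> tq; rewrite /f; case: ltP => [xt|tx]; last first.
  (* Here [f] is 0 by convention, and the block also starts before [x], so both values of [hit]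
     vanish. *)
  rewrite !hit0 ?subrr //; have : (q - 1) * K < 0 by lia.
  lia.
have /eqP-> : ceil_div (t - x) K == q by rewrite ceil_div_eq.
rewrite [K * _]mulrC; set s := x + (q - 1) * K.
have st : s <= t by rewrite /s; lia.
apply/eqP; rewrite eq_sym subr_eq addrC; apply/eqP; apply: PrD => R.
  rewrite -!first_candidate_le.
  by case: first_candidate => // i; move: st; clear; lia.
rewrite -first_candidate_le.
by case: first_candidate => // i; clear; lia.
Qed.

(** Full blocks telescope and the last [f] adds the partial block ending at [j - K]. Terms with
    [r <= 0] vanish, so [lo] is left free to cover the different lower limits in [c], [g] and
    [p_b]. *)
Lemma sum_f_hit lo x (j : int) : lo <= 0 -> x < j ->
  \zsum_(lo <= r <= ceil_div (j - x) K - 2) f N K x (x + r * K)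
  + f N K x (j - K) = hit x (j - K).
Proof.
move=> lo0 xj; have := ceil_divP (j - x) K_gt0; set q := ceil_div _ _ => jq.
have : 0 < q * K by lia.
rewrite pmulr_lgt0 // => q0.
rewrite (@f_hit _ _ (q - 1)); last by rewrite !mulrBl !mul1r in jq *; lia.
rewrite (_ : q - 1 - 1 = q - 2); last by lia.
have lo_le : lo - 1 <= q - 2 by lia.
have hit_lo : hit x (x + (lo - 1) * K) = 0.
  by apply: hit0; rewrite gerDl mulr_le0_ge0 //; lia.
have f_step r : f N K x (x + r * K) = hit x (x + r * K) - hit x (x + (r - 1) * K).
  by apply: f_hit; rewrite addrAC subrr add0r mulrBl mul1r; lia.
have /= := @telescope_zrange _ (fun r => hit x (x + r * K))
  (fun r => f N K x (x + r * K)) _ _ lo_le.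
rewrite subrK hit_lo add0r => <- => [|r _]; first by rewrite addrCA subrr addr0.
by rewrite f_step addrCA subrr addr0.
Qed.

Lemma miss_f lo x (j : int) : lo <= 0 -> x < j ->
  1 - \zsum_(lo <= r <= ceil_div (j - x) K - 2) f N K x (x + r * K)
  - f N K x (j - K) = miss x (j - K).
Proof. by move=> lo0 xj; rewrite -addrA -opprD sum_f_hit ?missE. Qed.

Lemma p_b_hit d1 d2 : d1 <= d2 -> p_b N K d1 d2 = hit d1 (d2 - K + 1).
Proof.
(* This is the telescoped sum at [j = d2 + 1]. *)
move=> d12; have -> : d2 - K + 1 = d2 + 1 - K by lia.
rewrite -(@sum_f_hit 0) /p_b //; last by lia.
have -> : d2 - d1 - K + 1 = d2 + 1 - d1 - K by lia.
rewrite ceil_divB1 // (_ : d2 - K + 1 = d2 + 1 - K); last by lia.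
by rewrite (_ : _ - 1 - 1 = ceil_div (d2 + 1 - d1) K - 2) //; lia.
Qed.

(** * Events fixed by the order of the first applicants, and events invariant under permuting
    them *)

Definition initial t := [set i : 'I_N | index1 i <= t].

Lemma candidate_order R R' m t : index1 m + K - 1 <= t ->
  same_order (initial t) R R' -> candidate K R m = candidate K R' m.
Proof.
move=> mt RR'.
have mem j : j%:Z < m%:Z + K -> j \in initial t.
  by move: mt; rewrite inE /index1; lia.
by apply/candidateP/candidateP => minm j jm; have := minm j jm; rewrite RR' // mem //; lia.
Qed.

Lemma no_candidate_order R R' x t u : t + K - 1 <= u ->
  same_order (initial u) R R' -> no_candidate R x t = no_candidate R' x t.
Proof.
move=> tu RR'; apply: eq_forallb => i.
case it : (x < index1 i <= t); last by rewrite !implybT.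
by rewrite (candidate_order (t := u) _ RR') //; lia.
Qed.

(** [s] fixes [m], and the applicants seen from [m] include all of [initial u], so [m] is still
    compared with the same set of ranks. *)
Lemma candidate_invariant R (s : 'S_N) m u : u < index1 m ->
  perm_on (initial u) s -> candidate K (s * R)%g m = candidate K R m.
Proof.
move=> um us.
have sub (s' R' : 'S_N) : perm_on (initial u) s' ->
    candidate K R' m -> candidate K (s' * R')%g m.
  move=> us' /candidateP minm; apply/candidateP => j jm.
  have sm : s' m = m by rewrite (out_perm us') // inE -ltNge.
  rewrite !permM sm minm //; case: (boolP (j \in initial u)) => [ju|/(out_perm us')-> //].
  have : s' j \in initial u by rewrite perm_closed.
  by move: um; rewrite inE /index1; lia.
apply/idP/idP; last exact: sub.
by rewrite -{2}(mulKg s R); apply: sub; rewrite perm_onV.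
Qed.

Lemma no_candidate_invariant R (s : 'S_N) x t u : u <= x ->
  perm_on (initial u) s -> no_candidate (s * R)%g x t = no_candidate R x t.
Proof.
move=> ux us; apply: eq_forallb => i.
case it : (x < index1 i <= t); last by rewrite !implybT.
by rewrite (candidate_invariant _ _ us) //; lia.
Qed.

Lemma best_invariant R (s : 'S_N) m u : u < index1 m ->
  perm_on (initial u) s -> (rank1 (s * R)%g m == 1%N) = (rank1 R m == 1%N).
Proof. by move=> um us; rewrite /rank1 permM (out_perm us) // inE -ltNge. Qed.

Lemma card_initial t : 0 <= t <= N%:Z -> #|initial t|%:Z = t.
Proof.
move=> tN; have -> : t = `|t|%N by lia.
have tN' : (`|t| <= N)%N by lia.
have widen_inj : injective (widen_ord tN').
  by move=> i j /(congr1 val) /= /val_inj.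
congr Posz; rewrite -[RHS]card_ord -(card_imset _ widen_inj).
apply: eq_card => i; rewrite inE /index1; apply/idP/imsetP => [it|[k _ ->] /=].
  have it' : (i < `|t|)%N by lia.
  by exists (Ordinal it'); rewrite // ; apply: val_inj.
by have := ltn_ord k; lia.
Qed.

(** * Probabilities of being best, of being a candidate, and of being chosen first *)

Lemma best_min R m : (rank1 R m == 1%N) = [forall k in [set: 'I_N], (R m <= R k)%N].
Proof.
apply/eqP/forall_inP => [[Rm] k _|min_m]; first by rewrite Rm.
case: N R m min_m => [|n] R m min_m; first by case: m {min_m}.
have := min_m (R^-1 ord0)%g (in_setT _); rewrite permKV /= leqn0.
by rewrite /rank1 => /eqP->.
Qed.

Lemma best_candidate R m : rank1 R m == 1%N -> candidate K R m.
Proof.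
by rewrite best_min => /forall_inP min_m; apply/candidateP => j _; apply: min_m.
Qed.

Lemma Pr_best m : Pr [set R | rank1 R m == 1%N] = N%:R^-1.
Proof.
rewrite (eq_Pr (fun R => best_min R m)) Pr_min ?in_setT //.
by rewrite cardsT card_ord.
Qed.

(** With the window not truncated, [m] must be minimal among exactly [index1 m + K - 1]
    applicants. *)
Lemma Pr_candidate m : index1 m + K - 1 <= N%:Z ->
  Pr [set R | candidate K R m] = (index1 m + K - 1)%:~R^-1.
Proof.
move=> mN; rewrite -(@card_initial (index1 m + K - 1)); last by rewrite /index1 in mN *; lia.
rewrite -pmulrn -(@Pr_min _ _ m); last by rewrite inE; lia.
apply: eq_Pr => R; apply/candidateP/forall_inP => min_m j.
  by rewrite inE /index1 => jm; apply: min_m; lia.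
by move=> jm; apply: min_m; rewrite inE /index1; lia.
Qed.

Lemma PrI_indep t (P Q : pred 'S_N) :
  (forall R R', same_order (initial t) R R' -> P R = P R') ->
  (forall R (s : 'S_N), perm_on (initial t) s -> Q (s * R)%g = Q R) ->
  Pr [set R | P R && Q R] = Pr [set R | P R] * Pr [set R | Q R].
Proof.
move=> detP invQ; rewrite -(@Pr_indep _ (initial t)) => [|R R'|s R us].
- by congr Pr; apply/setP => R; rewrite !inE.
- by rewrite !inE; apply: detP.
- by rewrite !inE invQ.
Qed.

(** The windows of indices up to [index1 m - K] end at [index1 m - 1] or earlier, whereas [m] being
    best is invariant under permuting the applicants before [m]. *)
Lemma Pr_win x m :
  Pr [set R | no_candidate R x (index1 m - K) && (rank1 R m == 1%N)]
  = miss x (index1 m - K) / N%:R.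
Proof.
rewrite (@PrI_indep (index1 m - 1)) ?Pr_best // => [R R'|R s us].
  by apply: no_candidate_order; lia.
by apply: best_invariant us; lia.
Qed.

Lemma Pr_first x m : x < index1 m -> index1 m + K - 1 <= N%:Z ->
  Pr [set R | first_candidate K R x == Some m] = c N K (index1 m) x.
Proof.
move=> xm mN; rewrite (eq_Pr (fun R => first_candidate_some R xm)).
rewrite (@eq_Pr _ _ (fun R => no_candidate R x (index1 m - K) && candidate K R m)); last first.
  by move=> R; rewrite andbC.
rewrite (@PrI_indep (index1 m - 1)) ?Pr_candidate // => [|R R'|R s us].
- by rewrite /c leNgt xm /= mulrC miss_f.
- by apply: no_candidate_order; lia.
- by apply: candidate_invariant us; lia.
Qed.


(** * One-step recurrences for the three winning probabilities *)

Lemma first_choice_win R x m : x < index1 m ->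
  (first_candidate K R x == Some m) && (rank1 R m == 1%N)
  = no_candidate R x (index1 m - K) && (rank1 R m == 1%N).
Proof.
move=> xm; rewrite first_candidate_some //.
by case best: (rank1 R m == 1%N); rewrite ?andbF // best_candidate.
Qed.

Lemma sigma1_step d1 m : d1 < index1 m ->
  sigma1 N K d1 (index1 m) =
  sigma1 N K d1 (index1 m - 1) + N%:R^-1 * miss d1 (index1 m - K).
Proof.
move=> d1m; rewrite mulrC -Pr_win /sigma1 /first_choice; apply: PrD => R.
  rewrite -first_choice_win //; case: first_candidate => // i.
  rewrite -[Some i == _]/(i == m); case: (i =P m) => [->|/eqP].
    by rewrite /index1; case: (rank1 R m == 1%N) => //=; lia.
  by rewrite -val_eqE /= /index1; case: (rank1 R i == 1%N) => //=; lia.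
rewrite -first_choice_win //; case: first_candidate => // i.
by rewrite -[Some i == _]/(i == m); case: (i =P m) => [->|]; rewrite ?andbF //; lia.
Qed.

(** The searches separate at [d2]: a first choice at index at most [d2 - K + 1] is settled by the
    order of the first [d2] applicants, and the second search then starts from [d2] itself. *)
Lemma sigma2_step d1 d2 m : d2 < index1 m ->
  sigma2 N K d1 d2 (index1 m) =
  sigma2 N K d1 d2 (index1 m - 1)
  + hit d1 (d2 - K + 1) * (N%:R^-1 * miss d2 (index1 m - K)).
Proof.
move=> d2m.
have -> : hit d1 (d2 - K + 1) * (N%:R^-1 * miss d2 (index1 m - K)) =
    Pr [set R | ~~ no_candidate R d1 (d2 - K + 1)
      && (no_candidate R d2 (index1 m - K) && (rank1 R m == 1%N))].
  rewrite (@PrI_indep d2) => [|R R' RR'|R s us].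
  - by rewrite Pr_win [_^-1 * _]mulrC.
  - by congr (~~ _); apply: no_candidate_order RR'; lia.
  - by rewrite (no_candidate_invariant _ _ (lexx d2) us) (best_invariant _ d2m us).
rewrite /sigma2 /second_choice /first_choice; apply: PrD => R.
  rewrite -first_choice_win // -first_candidate_le.
  case: (first_candidate K R d1) => // i.
  case: (boolP (index1 i <= d2 - K + 1)) => id2 /=; last first.
    by case: first_candidate => // j; move: id2; clear; lia.
  rewrite (_ : Order.max (index1 i) d2 = d2); last by lia.
  rewrite (_ : index1 i < d2 - K + 2); last by lia.
  case: first_candidate => // j; rewrite -[Some j == _]/(j == m) /=.
  case: (j =P m) => [->|/eqP].
    by rewrite /index1; case: (rank1 R m == 1%N) => //=; lia.
  by rewrite -val_eqE /= /index1; case: (rank1 R j == 1%N) => //=; lia.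
rewrite -first_choice_win // -first_candidate_le.
case: (first_candidate K R d1) => // i.
case: (boolP (index1 i <= d2 - K + 1)) => id2 /=; last by rewrite andbF.
rewrite (_ : Order.max (index1 i) d2 = d2); last by lia.
case: first_candidate => // j; rewrite -[Some j == _]/(j == m).
by case: (j =P m) => [->|]; rewrite ?andbF //; lia.
Qed.

Lemma g_miss x (m b : int) : m + K <= b ->
  g N K m x b = c N K m x * miss (m + K - 1) (b - K).
Proof.
move=> mb; rewrite /g ltNge (_ : K <= b - m) /=; last by lia.
congr (_ * _); rewrite -(@miss_f (-3)) //; last by lia.
have -> : b - m - K + 1 = b - (m + K - 1) by lia.
set q := ceil_div _ _.
(* [g] measures its blocks from [m - 1] instead of [m + K - 1], which shifts [r] by one. *)
rewrite (_ : -2 = -3 + 1) // (_ : q - 1 = q - 2 + 1); last by lia.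
rewrite big_zrange_shift; congr (_ - _ - _); apply: eq_bigr => r _.
by congr f; rewrite mulrDl mul1r; lia.
Qed.

Lemma candidate_gap R i j : candidate K R i -> candidate K R j ->
  index1 i < index1 j -> index1 i + K <= index1 j.
Proof.
move=> /candidateP Ri /candidateP Rj ij; rewrite leNgt; apply/negP => ji.
move: ij ji; rewrite /index1 => ij ji.
suff ji_eq : j = i by move: ij; rewrite ji_eq; lia.
apply: (@perm_inj _ R); apply: val_inj; apply/eqP.
by rewrite eqn_leq Rj ?Ri //; lia.
Qed.

(* The window of a candidate [i] contains no later candidate, so the second
   search effectively resumes at [index1 i + K]. *)
Lemma second_choice_win d1 d2 R i m :
  first_choice K d1 R = Some i -> d2 - K + 1 < index1 i -> d2 < index1 m ->
  (second_choice K d1 d2 R == Some m) && (rank1 R m == 1%N) =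
  [&& index1 i + K <= index1 m,
      no_candidate R (index1 i + K - 1) (index1 m - K) & rank1 R m == 1%N].
Proof.
move=> first_i d2i d2m; rewrite /second_choice first_i.
have Ri : candidate K R i.
  by move: first_i; rewrite /first_choice; case: first_candidateP => // ? ? _ _ [<-].
set y := Order.max _ _.
have iy : index1 i <= y by rewrite /y; lia.
have yi : y < index1 i + K by rewrite /y; lia.
case: (boolP (index1 i + K <= index1 m)) => im /=.
  rewrite first_choice_win; last by lia.
  congr (_ && _); apply/no_candidateP/no_candidateP => nc j Rj xj; apply: nc => //.
    by lia.
  by have := candidate_gap Ri Rj; lia.
apply/negbTE/negP => /andP[/eqP second_m /best_candidate Rm].
have ym : y < index1 m.
  by move: second_m; case: first_candidateP => // ? _ + _ [<-].
by have := candidate_gap Ri Rm; lia.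
Qed.

(** The new event, winning at [m], is split by the index [k] of the first choice; for each [k] the
    two searches separate at [k + K - 1], the end of the window of [k]. *)
Lemma sigma3_step d1 d2 m : 0 <= d1 -> d2 < index1 m ->
  sigma3 N K d1 d2 (index1 m) =
  sigma3 N K d1 d2 (index1 m - 1)
  + N%:R^-1 * \zsum_(d2 - K + 2 <= k <= index1 m - 1) g N K k d1 (index1 m).
Proof.
move=> d1_ge0 d2m.
(* Winning at [m] with the first choice after [d2 - K + 1] and at most [t]; raising [t] by one adds
   a single value of [k]. *)
pose W t R := if first_choice K d1 R is Some i then
  [&& d2 - K + 1 < index1 i <= t, second_choice K d1 d2 R == Some m
    & rank1 R m == 1%N] else false.
transitivity (sigma3 N K d1 d2 (index1 m - 1) + Pr [set R | W (index1 m - 1) R]).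
  apply: PrD => R; rewrite /W; case first_i: first_choice => [i|] //.
    case second_j: second_choice => [j|]; last by rewrite andbF.
    case: (boolP (d2 - K + 1 < index1 i)) => d2i; last by rewrite !andbF.
    have := second_choice_win first_i d2i d2m; rewrite second_j.
    rewrite -[Some j == _]/(j == m) /=; case: (j =P m) => [->|/eqP].
      by rewrite /index1; case: (rank1 R m == 1%N) => //=; lia.
    by rewrite -val_eqE /= /index1; case: (rank1 R j == 1%N) => //=; lia.
  case second_j: second_choice => [j|] //.
  rewrite -[Some j == _]/(j == m) /=; case: (j =P m) => [->|_]; last by rewrite !andbF.
  lia.
congr (_ + _); rewrite mulr_sumr.
have W0 : Pr [set R | W (d2 - K + 1) R] = 0.
  apply: Pr_pred0 => R; rewrite /W; case: first_choice => // i /=.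
  by rewrite (_ : (_ < _ <= _) = false) //; lia.
have d2m' : d2 - K + 1 <= index1 m - 1 by lia.
rewrite (_ : d2 - K + 2 = d2 - K + 1 + 1); last by lia.
have /= := @telescope_zrange _ (fun t => Pr [set R | W t R])
  (fun k => N%:R^-1 * g N K k d1 (index1 m)) _ _ d2m'.
rewrite W0 add0r; apply=> k kd2.
(* The range of [k] may start at or below [d1], even below 1; there [c] is 0 and no first choice
   occurs. *)
have [kd1|d1k] := leP k d1.
  rewrite /g /c kd1 mul0r if_same mulr0 addr0; apply: eq_Pr => R.
  rewrite /W /first_choice; case: first_candidateP => // i _ d1i _.
  rewrite (_ : (d2 - K + 1 < index1 i <= k) = false); last by lia.
  by rewrite (_ : (d2 - K + 1 < index1 i <= k - 1) = false) //; lia.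
have kN : (`|k - 1| < N)%N by have := ltn_ord m; rewrite /index1 in kd2; lia.
pose i0 := Ordinal kN.
have i0k : index1 i0 = k by rewrite /index1 /=; lia.
have Wk : Pr [set R | W k R] = Pr [set R | W (k - 1) R] +
    Pr [set R | (first_choice K d1 R == Some i0) && ((k + K <= index1 m) &&
      (no_candidate R (k + K - 1) (index1 m - K) && (rank1 R m == 1%N)))].
  apply: PrD => R; rewrite /W; case first_i: first_choice => [i|] //.
    rewrite -[Some i == _]/(i == i0); case: (i =P i0) => [ii0|/eqP ii0].
      have ik : index1 i = k by rewrite ii0.
      have d2i : d2 - K + 1 < index1 i by rewrite ik; lia.
      have := second_choice_win first_i d2i d2m; rewrite ik => <- /=.
      by case: ((second_choice _ _ _ _ == _) && _); lia.
    move: ii0; rewrite -val_eqE /= /index1 => ii0.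
    by case: ((second_choice _ _ _ _ == _) && _); lia.
  rewrite -[Some i == _]/(i == i0); case: (i =P i0) => [->|_]; last by rewrite andbF.
  by rewrite i0k; lia.
(* If [m] lies in the window of [k], both the event and [g] vanish. *)
rewrite Wk; congr (_ + _); case: (boolP (k + K <= index1 m)) => km; last first.
  rewrite Pr_pred0 => [|R]; last by rewrite andbF.
  by rewrite /g (_ : index1 m - k < K) ?mulr0 //; lia.
rewrite g_miss // (@PrI_indep (k + K - 1)) => [|R R' RR'|R s us].
- rewrite /= Pr_win (Pr_first (m := i0)) ?i0k //; first by rewrite mulrA mulrC.
  by have := ltn_ord m; rewrite /index1 in km; lia.
- rewrite /first_choice !first_candidate_some ?i0k //.
  congr (_ && _); first by apply: candidate_order RR'; lia.
  by apply: no_candidate_order RR'; lia.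
- have kKm : k + K - 1 < index1 m by lia.
  by rewrite (no_candidate_invariant _ _ (lexx _) us) (best_invariant _ kKm us).
Qed.

End Candidates.

(** * Summing the recurrences over a block *)

(** All [j] in the last block share the ceiling [q], so the inner sum of the theorem, written with
    [q], is the right one for each of them. *)
Lemma ceil_div_block (K d q j : int) : 0 < K ->
  d + (q - 1) * K + 1 <= j <= d + q * K -> ceil_div (j - d) K = q.
Proof. by move=> K0 jq; apply/eqP; rewrite ceil_div_eq //; lia. Qed.

Lemma int_index1 N (j : int) : 1 <= j <= N%:Z -> exists m : 'I_N, index1 m = j.
Proof.
move=> jN; have jN' : (`|j - 1| < N)%N by lia.
by exists (Ordinal jN'); rewrite /index1 /=; lia.
Qed.

Theorem theorem5p5 (N : nat) (K d1 d2 a : int)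
    (hK : 1 <= K <= N%:Z) (hd : 0 <= d1 <= d2) (hd2 : d2 < N%:Z)
    (ha : a <= N%:Z) :
  [/\ d1 < a ->
        forall q : int, q = ceil_div (a - d1) K ->
        sigma1 N K d1 a =
          sigma1 N K d1 (d1 + (q - 1) * K)
          + N%:R^-1 * (\zsum_(d1 + (q - 1) * K + 1 <= j <= a)
              (1 - (\zsum_(-1 <= r <= q - 2) f N K d1 (d1 + r * K))
                 - f N K d1 (j - K))),
      d2 < a ->
        forall q : int, q = ceil_div (a - d2) K ->
        sigma2 N K d1 d2 a =
          sigma2 N K d1 d2 (d2 + (q - 1) * K)
          + p_b N K d1 d2 / N%:R * (\zsum_(d2 + (q - 1) * K + 1 <= j <= a)
              (1 - (\zsum_(-1 <= r <= q - 2) f N K d2 (d2 + r * K))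
                 - f N K d2 (j - K)))
    & d2 < a ->
        sigma3 N K d1 d2 a =
          sigma3 N K d1 d2 (a - 1)
          + N%:R^-1 * (\zsum_(d2 - K + 2 <= m <= a - 1) g N K m d1 a)].
Proof.
have K0 : 0 < K by lia.
(* Common form of the first two formulas, with [p] equal to the inverse of [N] for [sigma1] and to
   [p_b] over [N] for [sigma2]. *)
have block d q (F : int -> rat) p : 0 <= d -> d < a -> q = ceil_div (a - d) K ->
    (forall m : 'I_N, d < index1 m -> F (index1 m) =
      F (index1 m - 1) + p * miss N K d (index1 m - K)) ->
    F a = F (d + (q - 1) * K) + p * (\zsum_(d + (q - 1) * K + 1 <= j <= a)
      (1 - (\zsum_(-1 <= r <= q - 2) f N K d (d + r * K)) - f N K d (j - K))).
  move=> d0 da qE Fstep; have := ceil_divP (a - d) K0; rewrite -qE => aq.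
  have q0 : 0 < q * K by lia.
  rewrite pmulr_lgt0 // in q0.
  have q1 : 0 <= (q - 1) * K by apply: mulr_ge0; lia.
  rewrite mulr_sumr; apply: telescope_zrange => [|j jq]; first by lia.
  have /int_index1[m mj] : 1 <= j <= N%:Z by lia.
  have jq' : ceil_div (j - d) K = q by apply: ceil_div_block => //; lia.
  rewrite -[q in q - 2]jq' (@miss_f N K) //; last by lia.
  by rewrite -mj Fstep ?mj //; lia.
split=> [d1a q qE|d2a q qE|d2a].
- by apply: block => // [|m]; [lia | apply: sigma1_step].
- apply: (block d2 q (sigma2 N K d1 d2)) => // [|m d2m]; first by lia.
  rewrite sigma2_step // mulrA; congr (_ + _ / _ * _).
  by rewrite p_b_hit //; lia.
- have /int_index1[m mj] : 1 <= a <= N%:Z by lia.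
  by rewrite -mj; apply: sigma3_step => //; lia.
Qed.
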